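(* Let $G$ be a connected signed planar graph with $c$ edges, let $D$ be the link diagram corresponding to $G$, let $M(D)$ be the incidence matrix of $D$, and let $n\geq 1$ be an integer. Then $G$ represents an $n$-component link diagram (i.e. $D$ is a diagram of a link with exactly $n$ components) if and only if the $\mathbb{Z}_2$-rank of $M(D)$ equals $c-n+1$.
   Context: A signed planar graph is a finite graph (loops and multiple edges allowed) embedded in the plane with a sign attached to each edge. Correspondence with link diagrams: given a link diagram $D$ in $\mathbb{R}^2$ (always assumed non-split, i.e. connected when viewed as a 4-valent planar graph with the crossings as vertices), colour its regions (components of the complement of the projection) black and white in checkerboard fashion with the unbounded region white. Then $G$ has one vertex for each black region and one edge for each crossing, the edge joining the (possibly equal) black regions that meet at that crossing; the sign of the edge records the over/under information of the crossing relative to the colouring. Conversely, every connected signed planar graph $G$ arises in this way from a link diagram $D$, whose underlying 4-valent graph is the medial graph of $G$ and whose crossing information is determined by the signs. The components of $D$ are the closed curves traced by going straight through at each crossing; their number does not depend on the signs. Let $G'$ be the planar dual graph of $G$; its vertices correspond to the white regions of $D$ and its edges are in bijection with the edges of $G$, hence with the crossings of $D$. The incidence matrix $M(\Gamma)$ of a graph $\Gamma$ is the matrix with rows indexed by vertices $x$ and columns indexed by edges $y$, with entry $1$ if $y$ is incident with $x$ and $0$ otherwise (so a loop contributes the entry $1$ at its vertex). Using the bijection of edges of $G$ and $G'$ to identify columns, the incidence matrix of $D$ is the $(c+2)\times c$ matrix $$M(D)=\begin{bmatrix} M(G)\\ M(G')\end{bmatrix}.$$ Equivalently, rows of $M(D)$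 correspond to the regions $R_i$ of $D$, columns to the crossings $P_j$ of $D$, and the $(i,j)$ entry is $1$ if $P_j$ lies on the boundary of $R_i$ and $0$ otherwise. The $\mathbb{Z}_2$-rank is the rank over the field $\mathbb{Z}_2=\mathbb{Z}/2\mathbb{Z}$; it does not depend on the orderings of vertices and edges. *)

(* Defs.v *)
From mathcomp Require Import all_boot all_algebra all_fingroup.

Set Implicit Arguments.
Unset Strict Implicit.
Unset Printing Implicit Defensive.

Import GRing.Theory.

(** * Graphs (loops and multiple edges allowed)

    Every edge [y] is cut into its two ends, the darts [(y, true)] and
    [(y, false)]; a dart is read as the edge directed away from that end. *)

Record graph := Graph {
  vertex : finType;
  edge : finType;
  org : edge * bool -> vertex
}.

Definition dart (G : graph) : finType := (edge G * bool)%type.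

Definition flip (E : Type) (d : E * bool) : E * bool := (d.1, ~~ d.2).

Lemma flipK (E : Type) : involutive (@flip E).
Proof. by case=> y b; rewrite /flip /= negbK. Qed.

Definition flip_perm (E : finType) : {perm E * bool} := perm (can_inj (@flipK E)).

Definition adjacent (G : graph) : rel (vertex G) :=
  [rel u v | [exists d : dart G, (org d == u) && (org (flip d) == v)]].

Definition connected (G : graph) : Prop :=
  0 < #|vertex G| /\ forall u v : vertex G, connect (@adjacent G) u v.

Definition incident (G : graph) (x : vertex G) (y : edge G) : bool :=
  [exists b : bool, org (y, b) == x].

Definition incidence_mx (G : graph) : 'M['F_2]_(#|vertex G|, #|edge G|) :=
  \matrix_(i, j) ((incident (enum_val i) (enum_val j))%:R)%R.

(** * Connected signed plane graphs

    An embedding in the oriented plane is encoded by its rotation system: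
    [rotation d] is the dart following [d] counterclockwise around [org d].  The face
    lying to the left of [d] is bounded by the orbit of [d] under
    [d |-> rotation^-1 (flip d)].  Planarity is Euler's formula (genus 0).  The choice
    of the unbounded face is not recorded, as none of the notions below
    depends on it. *)

Definition face_perm (E : finType) (r : {perm E * bool}) : {perm E * bool} :=
  (flip_perm E * r^-1)%g.

(* A face is given by the set of darts that have it on their left.  The
   connected graph without edges (a single point) has one face, with an empty
   boundary. *)
Definition faces (E : finType) (r : {perm E * bool}) : {set {set E * bool}} :=
  if #|E| == 0 then [set set0] else porbits (face_perm r).

Record connected_signed_plane_graph := SignedPlaneGraph {
  base :> graph;
  rotation : {perm dart base};
  rotationP : forall d d' : dart base, (d' \in porbit rotation d) = (org d' == org d);
  sign : edge base -> bool;
  base_connected : connected base;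
  base_planar : #|vertex base| + #|faces rotation| = #|edge base| + 2
}.

Definition face (G : connected_signed_plane_graph) : finType :=
  {A : {set dart G} | A \in faces (rotation G)}.

Lemma left_face_subproof (G : connected_signed_plane_graph) (d : dart G) :
  porbit (face_perm (rotation G)) d \in faces (rotation G).
Proof.
rewrite /faces; case: eqP => [E0|_]; last exact: imset_f.
by have := card0_eq E0 d.1.
Qed.

Definition left_face (G : connected_signed_plane_graph) (d : dart G) : face G :=
  exist (fun A => A \in faces (rotation G)) _ (left_face_subproof d).

(* The dual has the same edge type, so that columns of the two incidence
   matrices are identified; the dual of an edge joins the faces on its sides. *)
Definition dual (G : connected_signed_plane_graph) : graph :=
  @Graph (face G) (edge G) (@left_face G).

(** * Link diagrams

    A connected diagram is a connected 4-valent plane graph with over/under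
    information.  It is given by its half-edges at the crossings: [turn] is the
    counterclockwise rotation around a crossing and [arc] matches the two
    halves of an edge of the 4-valent graph; [over h] says that [h] belongs to
    the overcrossing strand.  The diagram without half-edges is the circle
    without crossings, whose complement has two regions. *)

Definition nb_regions (H : finType) (turn arc : {perm H}) : nat :=
  if #|H| == 0 then 2 else #|porbits (arc * turn)%g|.

Record link_diagram := LinkDiagram {
  half_edge : finType;
  turn : {perm half_edge};
  arc : {perm half_edge};
  over : half_edge -> bool;
  four_valent : forall h, #|porbit turn h| = 4;
  arc_involutive : involutive arc;
  arc_free : forall h, arc h != h;
  over_alt : forall h, over (turn h) = ~~ over h;
  diagram_connected :
    forall h h', connect [rel x y | (y == turn x) || (y == arc x)] h h';
  diagram_planar :
    #|porbits turn| + nb_regions turn arc = #|half_edge|./2 + 2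
}.

(* Going straight through a crossing leads from [h] to the opposite half-edge
   [turn (turn h)]. *)
Definition same_strand (D : link_diagram) : rel (half_edge D) :=
  [rel x y | (y == turn D (turn D x)) || (y == arc D x)].

Definition nb_components (D : link_diagram) : nat :=
  if #|half_edge D| == 0 then 1 else n_comp (@same_strand D) predT.

(** * The diagram of a signed plane graph

    The half-edge [(d, true)] (resp. [(d, false)]) of the medial graph starts at
    the midpoint of the edge of [d] and goes towards the vertex [org d] on the
    left (resp. right) side of [d].  With [d] drawn from west to east, the
    half-edges (d, true), (d, false), (flip d, true), (flip d, false) point
    north-west, south-west, south-east, north-east. The medial edge crossing
    the corner between [d] and [rotation d] joins [(d, true)] to [(rotation d, false)]. *)

Section Medial.
Variable G : connected_signed_plane_graph.
Let H : finType := (dart G * bool)%type.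

Definition medial_turn_fun (h : H) : H :=
  if h.2 then (h.1, false) else (flip h.1, true).

Definition medial_arc_fun (h : H) : H :=
  if h.2 then (rotation G h.1, false) else ((rotation G)^-1%g h.1, true).

Lemma medial_turn_inj : injective medial_turn_fun.
Proof.
move=> [d []] [d' []]; rewrite /medial_turn_fun /=; [ | by case | by case | ].
- by case=> ->.
- by case: d d' => [y b] [y' b'] [-> /negb_inj ->].
Qed.

Lemma medial_arc_funK : involutive medial_arc_fun.
Proof. by case=> d []; rewrite /medial_arc_fun /= ?permK ?permKV. Qed.

Definition medial_turn : {perm H} := perm medial_turn_inj.
Definition medial_arc : {perm H} := perm (can_inj medial_arc_funK).

(* On a positive edge the strand through the left sides of the two darts is the
   overcrossing one. *)
Definition medial_over (h : H) : bool := h.2 == sign h.1.1.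

Lemma medial_four_valent h : #|porbit medial_turn h| = 4.
Proof.
have E (x : H) : medial_turn x = medial_turn_fun x by rewrite permE.
have t4 : iter 4 medial_turn h = h.
  by case: h => [[y b] []] /=; rewrite !E /medial_turn_fun /= /flip /= negbK.
have uq : uniq (traject medial_turn h 4).
  by case: h {t4} => [[y []] []]; rewrite /= !E /medial_turn_fun /= /flip /= !inE
    !xpair_eqE ?andbF ?andFb ?eqxx.
have -> : porbit medial_turn h = [set x in traject medial_turn h 4].
  apply/setP=> x; rewrite inE; apply/porbitP/trajectP => [[i ->]|[i _ ->]].
    exists (i %% 4); first by rewrite ltn_mod.
    rewrite permX [in LHS](divn_eq i 4) addnC iterD; congr iter.
    by elim: (i %/ 4) => // k IH; rewrite mulSn iterD IH.
  by exists i; rewrite permX.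
by rewrite cardsE (card_uniqP uq) size_traject.
Qed.

Lemma medial_arcK : involutive medial_arc.
Proof. by move=> h; rewrite !permE medial_arc_funK. Qed.

Lemma medial_arc_free h : medial_arc h != h.
Proof.
by rewrite permE; case: h => d []; rewrite /medial_arc_fun /= xpair_eqE andbF.
Qed.

Lemma medial_over_alt h : medial_over (medial_turn h) = ~~ medial_over h.
Proof.
rewrite permE /medial_over; case: h => d [] //=; rewrite /medial_turn_fun /=;
  by case: (sign _).
Qed.

Lemma medial_connected (h h' : H) :
  connect [rel x y | (y == medial_turn x) || (y == medial_arc x)] h h'.
Proof.
set e := (X in connect X); pose Q d := forall b, connect e h (d, b).
have stepT x : connect e h x -> connect e h (medial_turn x).
  by move=> hx; apply: connect_trans hx (connect1 _); rewrite /e /= eqxx.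
have stepA x : connect e h x -> connect e h (medial_arc x).
  by move=> hx; apply: connect_trans hx (connect1 _); rewrite /e /= eqxx orbT.
have Qt d : connect e h (d, true) -> Q d /\ connect e h (flip d, true).
  move=> ht; have hf := stepT _ ht; rewrite permE /medial_turn_fun /= in hf.
  have hr := stepT _ hf; rewrite permE /medial_turn_fun /= in hr.
  by split=> // -[].
have Qr d : Q d -> Q (flip d) by move=> /(_ true)/Qt[_ /Qt[]].
have Qrot d : Q d -> Q (rotation G d).
  move=> /(_ true)/stepA; rewrite permE /medial_arc_fun /= => /stepT.
  by rewrite permE /medial_turn_fun /= => /Qt[/Qr]; rewrite flipK.
have Qorg d d' : org d' == org d -> Q d -> Q d'.
  rewrite -rotationP => /porbitP[i ->] Qd; elim: i => [|i IH]; first by rewrite perm1.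
  by rewrite expgSr permM; apply: Qrot.
have Q0 : Q h.1.
  case: h @e @Q stepT stepA Qt Qr Qrot Qorg => d [] e Q stepT _ Qt Qr _ _ /=.
    by case: (Qt d (connect0 _ _)).
  have := stepT _ (connect0 _ _); rewrite permE /medial_turn_fun /=.
  by move=> /Qt[/Qr]; rewrite flipK.
have /connectP[p] := (base_connected G).2 (org h.1) (org h'.1).
have : forall d, org d == org h.1 -> Q d by move=> d /Qorg; apply.
elim: p (org h.1) => [|v p IH] u Qu /=; first by move=> _ E; case: h' E => d b E; apply: Qu; rewrite E.
case/andP=> /existsP[d /andP[/Qu/Qr Qd Ev]] pth; apply: IH pth => d' Ed'.
by apply: Qorg Qd; rewrite (eqP Ev).
Qed.

Lemma card_porbits_vertex : 0 < #|edge G| -> #|porbits (rotation G)| = #|vertex G|.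
Proof.
case/card_gt0P=> y0 _; pose star (v : vertex G) := [set d : dart G | org d == v].
have star_ex v : exists d : dart G, org d = v.
  have /connectP[[|w p] /=] := (base_connected G).2 v (org (y0, true)).
    by move=> _ E; exists (y0, true).
  by case/andP=> /existsP[d /andP[/eqP Ed _]] _ _; exists d.
have star_inj : injective star.
  move=> u v /setP E; case: (star_ex u) => d Ed; have := E d.
  by rewrite !inE Ed eqxx => /esym/eqP.
have starE d : porbit (rotation G) d = star (org d).
  by apply/setP=> d'; rewrite inE rotationP.
rewrite -(card_imset _ star_inj); congr #|pred_of_set _|; apply/setP=> A.
apply/imsetP/imsetP => [[d _ ->]|[v _ ->]]; first by exists (org d); rewrite ?starE.
by case: (star_ex v) => d <-; exists d; rewrite ?starE.
Qed.

Lemma card_porbits_split (T : finType) (s : {perm T * bool}) (a b : {perm T}) :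
  (forall x, s (x, true) = (a x, true)) -> (forall x, s (x, false) = (b x, false)) ->
  #|porbits s| = #|porbits a| + #|porbits b|.
Proof.
move=> sa sb; pose in_ (c : bool) (x : T) := (x, c).
have in_inj c : injective (in_ c) by move=> x y [].
have orbE c (r : {perm T}) : (forall x, s (x, c) = (r x, c)) ->
    forall x, porbit s (x, c) = in_ c @: porbit r x.
  move=> sr x; have srX i : (s ^+ i)%g (x, c) = ((r ^+ i)%g x, c).
    by elim: i => [|i IH]; rewrite ?perm1 // !expgSr !permM IH sr.
  apply/setP=> z; apply/porbitP/imsetP => [[i ->]|[_ /porbitP[i ->] ->]].
    by exists ((r ^+ i)%g x); rewrite ?srX //; apply/porbitP; exists i.
  by exists i; rewrite srX.
have cardE c (r : {perm T}) :
    #|[set in_ c @: (A : {set T}) | A in porbits r]| = #|porbits r|.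
  exact/card_imset/imset_inj/in_inj.
rewrite -(cardE true a) -(cardE false b) -cardsUI [X in _ = _ + X]eq_card0 ?addn0.
  congr #|pred_of_set _|; apply/setP=> B; rewrite inE; apply/imsetP/orP.
    case=> -[x []] _ ->; [left | right].
      by rewrite (orbE true a sa); apply/imset_f/imset_f.
    by rewrite (orbE false b sb); apply/imset_f/imset_f.
  case=> /imsetP[_ /imsetP[x _ ->] ->].
    by exists (x, true); rewrite ?(orbE true a sa).
  by exists (x, false); rewrite ?(orbE false b sb).
move=> B; rewrite inE; apply/andP=> -[/imsetP[_ /imsetP[x _ ->] ->]].
case/imsetP=> _ /imsetP[y _ ->] /setP/(_ (x, true)).
rewrite mem_imset ?porbit_id; last exact: in_inj.
by move=> /esym/imsetP[].
Qed.

Lemma card_medial_half : #|H| = #|edge G| * 4.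
Proof. by rewrite !card_prod card_bool -mulnA. Qed.

Lemma medial_planar :
  #|porbits medial_turn| + nb_regions medial_turn medial_arc = #|H|./2 + 2.
Proof.
have cards : #|H| = #|porbits medial_turn| * 4.
  rewrite -cardsT; apply: card_uniform_partition; last first.
    have -> : porbits medial_turn = orbit 'P <[medial_turn]> @: setT.
      have E h : porbit medial_turn h = orbit 'P <[medial_turn]> h.
        by rewrite porbit.unlock.
      by apply/setP=> A; apply/imsetP/imsetP=> [] [h _ ->]; exists h; rewrite ?E.
    apply: orbit_partition; apply/subsetP=> x _; rewrite !inE.
    by apply/subsetP=> h _; rewrite !inE.
  by move=> _ /imsetP[h _ ->]; apply: medial_four_valent.
have -> : #|porbits medial_turn| = #|edge G|.
  by apply/eqP; rewrite -(eqn_pmul2r (isT : 0 < 4)) -cards card_medial_half.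
have := base_planar G; rewrite /nb_regions /faces card_medial_half muln_eq0 orbF.
case: eqP => [-> //|/eqP]; rewrite -lt0n => E0.
rewrite (card_porbits_split (a := (face_perm (rotation G))^-1%g) (b := (rotation G)^-1%g)).
- rewrite !porbitsV card_porbits_vertex // [_ + #|vertex G|]addnC => ->.
  by rewrite -[4]/(2 * 2) mulnA !muln2 doubleK -addnn addnA.
- move=> d; have -> : (face_perm (rotation G))^-1%g d = flip (rotation G d).
    apply: (perm_inj (s := face_perm (rotation G))).
    by rewrite permKV permM [flip_perm _ _]permE flipK permK.
  by rewrite permM [medial_arc _]permE [medial_turn _]permE.
- by move=> d; rewrite permM [medial_arc _]permE [medial_turn _]permE.
Qed.

Definition diagram : link_diagram :=
  LinkDiagram medial_four_valent medial_arcK medial_arc_free medial_over_alt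
    medial_connected medial_planar.

End Medial.

Definition diagram_incidence_mx (G : connected_signed_plane_graph) :
    'M['F_2]_(#|vertex G| + #|face G|, #|edge G|) :=
  col_mx (incidence_mx G) (incidence_mx (dual G)).

(* Main.v *)
Require Import Defs.
From mathcomp Require Import all_boot all_algebra all_fingroup.
From mathcomp Require Import mxabelem zify.

(** Colour the strands of [D] with [Z/2] and let [S] be the set of crossings where
    two differently coloured strands meet.  Going around a region, the colour
    changes at its corners in [S], so every region has an even number of corners
    in [S], and only the constant colourings give [S = 0].  Conversely, if all
    regions have evenly many corners in [S], then by planar duality (the cuts of
    [G'] are the cycles of [G], by Euler's formula) [S] is the coboundary of a
    colouring of the black regions and of one of the white regions, and the sum
    of the two colours on one side of each arc colours the strands.  So these
    [S] form a space of dimension [n - 1].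

    It is the kernel of [M(D)], although [M(D)] counts the two corners of a
    region at a nugatory crossing (a loop of [G] or of [G']) only once: no nugatory
    crossing [P] belongs to an [S] in the kernel.  Otherwise cut [D] at [P] and add
    up the rows of the regions of a suitable colour on one side; [P] contributes 1,
    hence so does another nugatory crossing in [S], which cuts off a strictly
    smaller part of that side. *)

Set Implicit Arguments.
Unset Strict Implicit.
Unset Printing Implicit Defensive.

Import GRing.Theory.

(** * Linear algebra over a field and counting of invariant functions *)

Section Duality.
Local Open Scope ring_scope.

(** The hypothesis puts the left kernel inside the line of constant vectors. *)
Lemma rank_ker_const (F : fieldType) (V E : finType) (M : V -> E -> F) :
  (forall u : V -> F, (forall e, \sum_v u v * M v e = 0) -> forall v w, u v = u w) ->
  (#|V| <= \rank (\matrix_(i < #|V|, j < #|E|) M (enum_val i) (enum_val j)) + 1)%N.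
Proof.
move=> hM; set A := \matrix_(i, j) _.
suff /mxrankS : (kermx A <= (const_mx 1 : 'rV[F]_#|V|))%MS.
  rewrite mxrank_ker leq_subLR => /leq_trans; apply.
  by rewrite leq_add2l rank_leq_row.
apply/rV_subP=> u /sub_kermxP uA.
have cst : forall v w, u 0 (enum_rank v) = u 0 (enum_rank w).
  apply: hM => e; move/matrixP/(_ 0 (enum_rank e)): uA; rewrite !mxE => {2}<-.
  rewrite (reindex _ (onW_bij _ (@enum_val_bij V))) /=; apply: eq_bigr => i _.
  by rewrite mxE enum_valK enum_rankK.
have [v0|v0] := pickP (@predT 'I_#|V|).
  move=> _; apply/sub_rVP; exists (u 0 v0); apply/rowP=> j; rewrite !mxE mulr1.
  by have := cst (enum_val j) (enum_val v0); rewrite !enum_valK.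
suff -> : u = 0 by apply: sub0mx.
by apply/rowP=> j; have := v0 j.
Qed.

(** The row space of [M] lies in the orthogonal complement of that of [N]; since the ranks are at
    least [#|V| - 1] and [#|W| - 1], which add up to [#|E|], the two spaces coincide. *)
Lemma orth_of_rank (F : fieldType) (V W E : finType) (M : V -> E -> F) (N : W -> E -> F) :
  (forall u : V -> F, (forall e, \sum_v u v * M v e = 0) -> forall v w, u v = u w) ->
  (forall u : W -> F, (forall e, \sum_v u v * N v e = 0) -> forall v w, u v = u w) ->
  (forall v w, \sum_e M v e * N w e = 0) ->
  (#|V| + #|W| = #|E| + 2)%N ->
  forall S : E -> F, (forall w, \sum_e S e * N w e = 0) ->
  exists A : V -> F, forall e, S e = \sum_v A v * M v e.
Proof.
move=> /rank_ker_const hM /rank_ker_const hN MN euler S SN.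
set A := \matrix_(i < #|V|, j < #|E|) _ in hM.
set B := \matrix_(i < #|W|, j < #|E|) _ in hN.
have sAB : (A <= kermx B^T)%MS.
  apply/sub_kermxP/matrixP=> i k; rewrite !mxE -[RHS](MN (enum_val i) (enum_val k)).
  rewrite [RHS](reindex _ (onW_bij _ (@enum_val_bij E))) /=.
  by apply: eq_bigr => j _; rewrite !mxE.
have eqAB : (kermx B^T <= A)%MS.
  rewrite -(geq_leqif (mxrank_leqif_sup sAB)) mxrank_ker mxrank_tr leq_subLR.
  by rewrite -(leq_add2r 2) -euler addnC -[2%N]/(1 + 1)%N addnACA leq_add.
pose s := \row_(j < #|E|) S (enum_val j).
have /submxP[a sa] : (s <= A)%MS.
  apply: submx_trans eqAB; apply/sub_kermxP/rowP=> k; rewrite !mxE.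
  rewrite -[RHS](SN (enum_val k)) [RHS](reindex _ (onW_bij _ (@enum_val_bij E))) /=.
  by apply: eq_bigr => j _; rewrite !mxE.
exists (fun v => a 0 (enum_rank v)) => e.
move/rowP/(_ (enum_rank e)): sa; rewrite !mxE enum_rankK => ->.
rewrite [RHS](reindex _ (onW_bij _ (@enum_val_bij V))) /=.
by apply: eq_bigr => j _; rewrite !mxE enum_valK enum_rankK.
Qed.

Lemma card_ker_rV (F : finFieldType) m n (A : 'M[F]_(m, n)) :
  #|[set u : 'rV_m | u *m A == 0]| = (#|F| ^ (m - \rank A))%N.
Proof.
rewrite -mxrank_ker -card_rowg; apply: eq_card => u.
by rewrite !inE (sameP sub_kermxP eqP).
Qed.

(** An invariant function is a free choice of one value per component; [ext] spreads the values
    chosen at the roots. *)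
Lemma card_invariant (F : finType) (T : finType) (e : rel T) : connect_sym e ->
  #|[set y : {ffun T -> F} | [forall x, forall x', e x x' ==> (y x' == y x)]]|
    = (#|F| ^ n_comp e predT)%N.
Proof.
move=> sym; pose R := {x : T | x \in roots e}.
have -> : n_comp e predT = #|{: R}|.
  by rewrite card_sig; apply: eq_card => x; rewrite !inE andbT.
rewrite -card_ffun.
pose ext (z : {ffun R -> F}) : {ffun T -> F} :=
  [ffun x => z (exist _ (fingraph.root e x) (roots_root sym x))].
have rk (r : R) : fingraph.root e (val r) = val r by apply/eqP; exact: valP r.
rewrite -(card_imset (f := ext)); last first.
  move=> z z' /ffunP E; apply/ffunP=> r; have := E (val r); rewrite !ffunE.
  suff -> : exist _ (fingraph.root e (val r)) (roots_root sym (val r)) = r by [].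
  exact/val_inj/rk.
apply: eq_card => y; rewrite !inE; apply/idP/imsetP => [/forallP inv|[z _ ->]].
  exists [ffun r : R => y (val r)] => //; apply/ffunP=> x; rewrite !ffunE /=.
  have /connectP[p] := connect_root e x.
  elim: p x => [|x' p IH] x /=; first by move=> _ ->.
  case/andP=> exx' pth def.
  have /forallP/(_ x')/implyP/(_ exx')/eqP <- := inv x.
  have -> : fingraph.root e x = fingraph.root e x' by apply/(fingraph.rootP sym)/connect1.
  by apply: IH => //; rewrite -def; apply/(fingraph.rootP sym); rewrite sym connect1.
apply/forallP=> x; apply/forallP=> x'; apply/implyP=> exx'; rewrite !ffunE.
apply/eqP; congr (z _); apply: val_inj => /=.
by apply/(fingraph.rootP sym); rewrite sym connect1.
Qed.

(** * Arithmetic modulo 2 *)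

Lemma F2_cases (x : 'F_2) : x = 0 \/ x = 1.
Proof. by case: x => [[|[|m]] //= lt]; [left | right]; apply: val_inj. Qed.

Lemma F2_addxx (x : 'F_2) : x + x = 0.
Proof. by case: (F2_cases x) => ->; apply: val_inj. Qed.

Lemma F2_addKl (x y : 'F_2) : x + (x + y) = y.
Proof. by rewrite addrA F2_addxx add0r. Qed.

Lemma F2_addKr (x y : 'F_2) : x + (y + x) = y.
Proof. by rewrite addrCA F2_addxx addr0. Qed.

Lemma F2_opp (x : 'F_2) : - x = x.
Proof. by apply/esym/eqP; rewrite -addr_eq0 F2_addxx. Qed.

Lemma F2_add_eq0 (x y : 'F_2) : x + y = 0 -> x = y.
Proof. by move/eqP; rewrite addr_eq0 F2_opp => /eqP. Qed.

Lemma sum_dart (E : finType) (V : zmodType) (F : E * bool -> V) :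
  \sum_d F d = \sum_e (F (e, true) + F (e, false)).
Proof.
rewrite (eq_bigr (fun d => F (d.1, d.2))); last by case.
rewrite -(pair_bigA _ (fun e b => F (e, b))) /=.
by apply: eq_bigr => e _; rewrite big_bool.
Qed.

(** * Incidence and boundary modulo 2, for an end map that can be that of [G] or of its dual *)

Section Ends.
Variables (E V : finType) (o : E * bool -> V).

Lemma sum_delta (A : V -> 'F_2) (x : V) : \sum_v A v * (x == v)%:R = A x.
Proof.
rewrite (bigD1 x) //= eqxx mulr1 big1 ?addr0 // => v /negbTE.
by rewrite eq_sym => ->; rewrite mulr0.
Qed.

(* Unlike in [inc], which is [incident], a loop cancels here. *)
Definition ends_mx (v : V) (e : E) : 'F_2 := (o (e, true) == v)%:R + (o (e, false) == v)%:R.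

Lemma sum_ends_mx (A : V -> 'F_2) e :
  \sum_v A v * ends_mx v e = A (o (e, true)) + A (o (e, false)).
Proof.
by under eq_bigr do rewrite mulrDr; rewrite big_split /= !sum_delta.
Qed.

Definition inc (v : V) (e : E) : bool := [exists b : bool, o (e, b) == v].

Lemma inc_ends_mx v e : o (e, true) != o (e, false) -> (inc v e)%:R = ends_mx v e.
Proof.
move=> ne; have -> : inc v e = (o (e, true) == v) || (o (e, false) == v).
  apply/existsP/orP => [[[] ->]|[]]; by [left | right | exists true | exists false].
rewrite /ends_mx; case: (eqVneq (o (e, true)) v) ne => [-> /=|_ _] /=.
  by rewrite eq_sym => /negbTE ->; rewrite addr0.
by rewrite add0r.
Qed.

Lemma inc_loop v e : o (e, true) = o (e, false) -> inc v e = (o (e, true) == v).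
Proof. by move=> l; apply/existsP/idP => [[[]]|]; rewrite ?l //; exists true; rewrite ?l. Qed.

Lemma even_of_inc (S : E -> 'F_2) :
  (forall e, o (e, true) = o (e, false) -> S e = 0) ->
  forall v, \sum_e S e * (inc v e)%:R = \sum_e S e * ends_mx v e.
Proof.
move=> S0 v; apply: eq_bigr => e _.
by case: (eqVneq (o (e, true)) (o (e, false))) => [/S0 ->|/inc_ends_mx ->]; rewrite ?mul0r.
Qed.

(** Add the rows [inc v] with [A v = 1]. An edge with distinct ends contributes [S e] times the
    coboundary of [A], so among these only [P] counts. The total is 0, so a loop in [S], based where
    [A] is 1, must balance it. *)
Lemma exists_loop (S : E -> 'F_2) (A : V -> 'F_2) P :
  (forall v, \sum_e S e * (inc v e)%:R = 0) ->
  (forall e, A (o (e, true)) + A (o (e, false)) = (e == P)%:R) -> S P = 1 ->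
  exists Q, [/\ o (Q, true) = o (Q, false), S Q = 1 & A (o (Q, true)) = 1].
Proof.
move=> SK dA SP.
pose loop e := o (e, true) == o (e, false).
have [Q /and3P[/eqP lQ /eqP SQ /eqP AQ]|no] :=
  pickP [pred Q | [&& loop Q, S Q == 1 & A (o (Q, true)) == 1]]; first by exists Q.
have rest e : e != P -> \sum_v A v * (S e * (inc v e)%:R) = 0.
  move=> neP; under eq_bigr do rewrite mulrCA.
  rewrite -big_distrr /=; have [le|nle] := boolP (loop e).
    under eq_bigr do rewrite (inc_loop _ (eqP le)).
    rewrite sum_delta; have := no e; rewrite /= le /=.
    by case: (F2_cases (S e)) (F2_cases (A (o (e, true)))) => -> [] ->; rewrite ?mulr0 ?mul0r.
  under eq_bigr do rewrite inc_ends_mx //.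
  by rewrite sum_ends_mx dA (negbTE neP) mulr0.
have : \sum_v A v * (\sum_e S e * (inc v e)%:R) = 0.
  by apply: big1 => v _; rewrite SK mulr0.
under eq_bigr do rewrite big_distrr /=.
rewrite exchange_big /= (bigD1 P) //= [X in _ + X]big1 ?addr0 //.
under eq_bigr do rewrite mulrCA.
rewrite -big_distrr /= SP mul1r.
have nP : o (P, true) != o (P, false).
  by apply/eqP=> lP; have := dA P; rewrite lP F2_addxx eqxx.
under eq_bigr do rewrite inc_ends_mx //.
by rewrite sum_ends_mx dA eqxx.
Qed.

Lemma factor (T : Type) (g : E * bool -> T) (t0 : T) :
  (forall d d', o d = o d' -> g d = g d') -> exists A : V -> T, forall d, g d = A (o d).
Proof.
(* [t0] is the value at vertices without darts. *)
move=> gP; exists (fun v => if [pick d | o d == v] is Some d then g d else t0) => d.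
by case: pickP => [d' /eqP od|/(_ d)]; [apply: gP | rewrite eqxx].
Qed.

Lemma even_darts (S : E -> 'F_2) v :
  \sum_e S e * ends_mx v e = \sum_(d | o d == v) S d.1.
Proof.
rewrite [RHS]big_mkcond sum_dart; apply: eq_bigr => e _.
by rewrite mulrDr; congr (_ + _); case: eqP => _; rewrite ?mulr1 ?mulr0.
Qed.

End Ends.

(** * Orbits, cycles and cuts *)

Lemma porbit_const (X : finType) (T : Type) (s : {perm X}) (g : X -> T) x x' :
  (forall x, g (s x) = g x) -> x' \in porbit s x -> g x' = g x.
Proof.
move=> gs /porbitP[i ->]; elim: i => [|i IH]; first by rewrite perm1.
by rewrite expgSr permM gs.
Qed.

(** Membership in the cycle space modulo 2. *)
Definition even (E V : finType) (o : E * bool -> V) (S : E -> 'F_2) : Prop :=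
  forall v, \sum_e S e * ends_mx o v e = 0.

Definition even_is_cut (E V W : finType) (o : E * bool -> V) (l : E * bool -> W) : Prop :=
  forall S, even o S -> exists A : W -> 'F_2, forall e, S e = A (l (e, true)) + A (l (e, false)).

(** A loop alone is an even set, hence a cut for [l]; [A] marks one side of it. *)
Lemma even_is_cut_loop (E V W : finType) (o : E * bool -> V) (l : E * bool -> W) P :
  even_is_cut o l -> o (P, true) = o (P, false) ->
  exists A : W -> 'F_2, forall e, A (l (e, true)) + A (l (e, false)) = (e == P)%:R.
Proof.
move=> ol lP; have [v|A eA] := ol (fun e => (e == P)%:R); last by exists A.
rewrite (bigD1 P) //= big1 ?addr0 => [|e /negbTE ->]; last by rewrite mul0r.
by rewrite /ends_mx lP F2_addxx mulr0.
Qed.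

(** For [l] the loop [P] is a one-edge cut, and cuts are orthogonal to even sets. *)
Lemma even_loop0 (E V W : finType) (o : E * bool -> V) (l : E * bool -> W) S P :
  even_is_cut o l -> even l S -> o (P, true) = o (P, false) -> S P = 0.
Proof.
move=> ol lS /(even_is_cut_loop ol)[A dA].
have : \sum_w A w * (\sum_e S e * ends_mx l w e) = 0.
  by apply: big1 => w _; rewrite lS mulr0.
under eq_bigr do rewrite big_distrr /=.
rewrite exchange_big /= (bigD1 P) //= [X in _ + X]big1 ?addr0.
  by under eq_bigr do rewrite mulrCA; rewrite -big_distrr /= sum_ends_mx dA eqxx mulr1.
move=> e neP; under eq_bigr do rewrite mulrCA.
by rewrite -big_distrr /= sum_ends_mx dA (negbTE neP) mulr0.
Qed.

(** * Duality between [G] and its dual from Euler's formula *)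

Section Planar.
Variable G : connected_signed_plane_graph.
Hypothesis E0 : (#|edge G| != 0)%N.
Local Notation o := (@org G).
Local Notation l := (@left_face G).
Local Notation r := (rotation G).
Local Notation H := (dart G * bool)%type.

Lemma org_rotation d : o (r d) = o d.
Proof. by apply/eqP; rewrite -rotationP; have := mem_porbit r 1 d; rewrite expg1. Qed.

Lemma face_permE d : face_perm r d = r^-1%g (flip d).
Proof. by rewrite permM [flip_perm _ _]permE. Qed.

Lemma left_face_eq d d' : (l d' == l d) = (d' \in porbit (face_perm r) d).
Proof. by rewrite -val_eqE /= eq_porbit_mem. Qed.

Lemma left_face_perm d : l (face_perm r d) = l d.
Proof.
by apply/eqP; rewrite left_face_eq; have := mem_porbit (face_perm r) 1 d; rewrite expg1.
Qed.

(** The corner between [d] and [r d] lies in a single face. *)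
Lemma left_face_flip_rotation d : l (flip (r d)) = l d.
Proof. by rewrite -left_face_perm face_permE flipK permK. Qed.

Lemma org_const (T : Type) (g : dart G -> T) d d' :
  (forall d, g (r d) = g d) -> o d = o d' -> g d = g d'.
Proof. by move=> gr od; apply: (@porbit_const _ _ r) => //; rewrite rotationP od. Qed.

Lemma left_face_const (T : Type) (g : dart G -> T) d d' :
  (forall d, g (face_perm r d) = g d) -> l d = l d' -> g d = g d'.
Proof. by move=> gr ld; apply: (porbit_const gr); rewrite -left_face_eq ld. Qed.

Lemma turnE (h : H) : medial_turn G h = if h.2 then (h.1, false) else (flip h.1, true).
Proof. by rewrite permE. Qed.

Lemma arcE (h : H) :
  medial_arc G h = if h.2 then (r h.1, false) else (r^-1%g h.1, true).
Proof. by rewrite permE. Qed.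

Lemma half_edge_const (T : Type) (g : H -> T) (h h' : H) :
  (forall h, g (medial_turn G h) = g h) -> (forall h, g (medial_arc G h) = g h) -> g h = g h'.
Proof.
move=> gt ga; have /connectP[p] := medial_connected h h'.
elim: p h => [|x p IH] h /=; first by move=> _ ->.
by case/andP=> hx px def; rewrite -(IH x px def); case/orP: hx => /eqP ->; rewrite ?gt ?ga.
Qed.

Lemma dart_const (T : Type) (g : dart G -> T) d d' :
  (forall d, g (r d) = g d) -> (forall d, g (flip d) = g d) -> g d = g d'.
Proof.
move=> gr gf; apply: (half_edge_const (g := fun h => g h.1) (d, true) (d', true)) => -[x b].
  by rewrite turnE; case: b => /=.
by rewrite arcE; case: b => //=; rewrite -[in RHS](permKV r x) gr.
Qed.

Lemma org_surj v : exists d, o d = v.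
Proof.
have /card_gt0P[y0 _] : (0 < #|edge G|)%N by rewrite lt0n.
have /connectP[[|w p] /=] := (base_connected G).2 v (org (y0, true)).
  by move=> _ E; exists (y0, true).
by case/andP=> /existsP[d /andP[/eqP Ed _]] _ _; exists d.
Qed.

Lemma left_face_surj f : exists d, l d = f.
Proof.
have /imsetP[d _ Ad] : val f \in porbits (face_perm r).
  have <- : faces r = porbits (face_perm r) by rewrite /faces (negbTE E0).
  exact: valP.
by exists d; apply/val_inj/esym.
Qed.

(** Around [v] each corner is counted twice: on the left of [d] and on the left of [flip (r d)]. *)
Lemma orthogonal v f : \sum_e ends_mx o v e * ends_mx l f e = 0.
Proof.
under eq_bigr do rewrite mulrC.
rewrite even_darts.
rewrite (eq_bigr (fun d => (l d == f)%:R + (l (flip d) == f)%:R)); last first.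
  by case=> e [] _; rewrite /ends_mx /flip //= addrC.
rewrite big_split /= [X in _ + X](reindex_inj (@perm_inj _ r)) /=.
under [X in _ + X]eq_bigl do rewrite org_rotation.
by under [X in _ + X]eq_bigr do rewrite left_face_flip_rotation; rewrite F2_addxx.
Qed.

Lemma org_connected (u : vertex G -> 'F_2) :
  (forall e, \sum_v u v * ends_mx o v e = 0) -> forall v w, u v = u w.
Proof.
move=> u0 v w; case: (org_surj v) (org_surj w) => d <- [d' <-].
apply: (dart_const (g := u \o o)) => x /=; first by rewrite org_rotation.
by case: x => e []; have := u0 e; rewrite sum_ends_mx => /F2_add_eq0; rewrite /flip /= => ->.
Qed.

Lemma left_face_connected (u : face G -> 'F_2) :
  (forall e, \sum_v u v * ends_mx l v e = 0) -> forall v w, u v = u w.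
Proof.
move=> u0 v w; case: (left_face_surj v) (left_face_surj w) => d <- [d' <-].
have uf x : u (l (flip x)) = u (l x).
  by case: x => e []; have := u0 e; rewrite sum_ends_mx => /F2_add_eq0; rewrite /flip /= => ->.
by apply: (dart_const (g := u \o l)) => x //=; rewrite -[LHS]uf left_face_flip_rotation.
Qed.

Lemma euler : (#|vertex G| + #|face G| = #|edge G| + 2)%N.
Proof. by rewrite -base_planar card_sig. Qed.

Lemma even_left_face_is_cut : even_is_cut l o.
Proof.
move=> S /(orth_of_rank org_connected left_face_connected orthogonal euler)[A SA].
by exists A => e; rewrite SA sum_ends_mx.
Qed.

Lemma even_org_is_cut : even_is_cut o l.
Proof.
have orth f v : \sum_e ends_mx l f e * ends_mx o v e = 0.
  by under eq_bigr do rewrite mulrC; apply: orthogonal.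
have eul := euler; rewrite addnC in eul.
move=> S /(orth_of_rank left_face_connected org_connected orth eul)[A SA].
by exists A => e; rewrite SA sum_ends_mx.
Qed.

End Planar.

(** * Nugatory crossings and the kernel of [M(D)] *)

Section Nugatory.
Variable G : connected_signed_plane_graph.
Hypothesis E0 : (#|edge G| != 0)%N.
Local Notation o := (@org G).
Local Notation l := (@left_face G).
Local Notation r := (rotation G).
Local Notation H := (dart G * bool)%type.

(* [Y] is the indicator of a set of half-edges lying on one side of a closed curve
   that meets the diagram only at the crossing [P]; the curve leaves [P] through
   its two face corners if [c = false], its two vertex corners if [c = true]. *)
Definition pinched (Y : H -> 'F_2) (P : edge G) (c : bool) : Prop :=
  (forall h, Y (medial_arc G h) = Y h) /\
  (forall h, Y (medial_turn G h) = Y h + ((h.1.1 == P) && (h.2 == c))%:R).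

(** [A] marks one side of the bridge [P]. A turn from [(d, true)] keeps the vertex and a turn from
    [(d, false)] passes to the other end, hence [c = false]. *)
Lemma pinched_org (A : vertex G -> 'F_2) P :
  (forall e, A (o (e, true)) + A (o (e, false)) = (e == P)%:R) ->
  pinched (fun h => A (o h.1)) P false.
Proof.
move=> dA; split=> -[d []].
- by rewrite arcE /= org_rotation.
- by rewrite arcE /= -[in RHS](permKV r d) org_rotation.
- by rewrite turnE /= andbF addr0.
rewrite turnE /= andbT; case: d => e b; rewrite -dA /flip /=.
by case: b; rewrite /= ?F2_addKl ?F2_addKr.
Qed.

Lemma pinched_left_face (A : face G -> 'F_2) P :
  (forall e, A (l (e, true)) + A (l (e, false)) = (e == P)%:R) ->
  pinched (fun h => A (l (if h.2 then h.1 else flip h.1))) P true.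
Proof.
move=> dA; split=> -[d []].
- by rewrite arcE /= left_face_flip_rotation.
- by rewrite arcE /= -[in RHS](permKV r d) left_face_flip_rotation.
- rewrite turnE /= andbT; case: d => e b; rewrite -dA /flip /=.
  by case: b; rewrite /= ?F2_addKl ?F2_addKr.
by rewrite turnE /= andbF addr0.
Qed.

(** [Y] is fixed by arcs and by turns from [(d, true)], so it is constant around each vertex. *)
Lemma org_of_pinched Y P : pinched Y P false ->
  exists A : vertex G -> 'F_2, (forall h, Y h = A (o h.1)) /\
    forall e, A (o (e, true)) + A (o (e, false)) = (e == P)%:R.
Proof.
move=> [Ya Yt].
have Yf d : Y (d, false) = Y (d, true).
  by have := Yt (d, true); rewrite turnE /= andbF addr0.
have [d d' /org_const E|A AE] := @factor _ _ o _ (fun d => Y (d, true)) 0.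
  by apply: (E _ (fun d => Y (d, true))) => x; rewrite -Yf -Ya arcE /= permK.
have YA h : Y h = A (o h.1) by case: h => d [] /=; rewrite ?Yf.
exists A; split=> // e; have := Yt ((e, true), false).
by rewrite turnE /= !YA /= andbT /flip /= => ->; rewrite F2_addKl.
Qed.

Lemma left_face_of_pinched Y P : pinched Y P true ->
  exists A : face G -> 'F_2, (forall h, Y h = A (l (if h.2 then h.1 else flip h.1))) /\
    forall e, A (l (e, true)) + A (l (e, false)) = (e == P)%:R.
Proof.
move=> [Ya Yt].
have Yf d : Y (d, false) = Y (flip d, true).
  by have := Yt (d, false); rewrite turnE /= andbF addr0.
have [d d' /left_face_const E|A AE] := @factor _ _ l _ (fun d => Y (d, true)) 0.
  apply: (E _ (fun d => Y (d, true))) => x.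
  by rewrite face_permE -[x in RHS]flipK -Yf -[RHS]Ya arcE.
have YA h : Y h = A (l (if h.2 then h.1 else flip h.1)).
  by case: h => d [] /=; rewrite ?Yf AE.
exists A; split=> // e; have := Yt ((e, true), true).
by rewrite turnE /= !YA /= andbT /flip /= => ->; rewrite F2_addKl.
Qed.

Section Kernel.
Variable S : edge G -> 'F_2.
Hypothesis So : forall v, \sum_e S e * (inc o v e)%:R = 0.
Hypothesis Sl : forall f, \sum_e S e * (inc l f e)%:R = 0.

(** [Y] comes from a colouring of vertices or of faces with coboundary [P], so [exists_loop] finds a
    loop [Q] on the side [Y = 1]. A loop of one graph is a bridge of the other, which swaps [c]. *)
Lemma pinched_next Y P c : pinched Y P c -> S P = 1 ->
  exists Q, [/\ Q != P, S Q = 1, forall h, h.1.1 = Q -> Y h = 1 &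
                exists Y', pinched Y' Q (~~ c)].
Proof.
case: c => pY SP.
  have [A [YA dA]] := left_face_of_pinched pY.
  have [Q [lQ SQ AQ]] := exists_loop Sl dA SP; exists Q; split=> //.
  - by apply/eqP=> QP; have := dA P; rewrite -QP lQ F2_addxx eqxx.
  - by move=> [[e b] b'] /= eQ; rewrite YA eQ /flip; case: b b' => [] [] /=; rewrite -?lQ.
  have [A' dA'] := even_is_cut_loop (even_left_face_is_cut E0) lQ.
  by exists (fun h => A' (o h.1)); apply: pinched_org.
have [A [YA dA]] := org_of_pinched pY.
have [Q [lQ SQ AQ]] := exists_loop So dA SP; exists Q; split=> //.
- by apply/eqP=> QP; have := dA P; rewrite -QP lQ F2_addxx eqxx.
- by move=> [[e b] b'] /= eQ; rewrite YA eQ; case: b => /=; rewrite -?lQ.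
have [A' dA'] := even_is_cut_loop (even_org_is_cut E0) lQ.
exists (fun h => A' (l (if h.2 then h.1 else flip h.1))).
exact: pinched_left_face.
Qed.

(** The curve through [Q] misses [P], so the four half-edges at [P] lie on one side; adding a
    constant gives that side the value 0. *)
Lemma pinched_vanish Y P Q c : pinched Y Q c -> Q != P ->
  exists Y', pinched Y' Q c /\ forall h, h.1.1 = P -> Y' h = 0.
Proof.
move=> [Ya Yt] neQP; exists (fun h => Y h + Y ((P, true), true)); split.
  by split=> h; rewrite ?Ya // Yt addrAC.
have t h : h.1.1 = P -> Y (medial_turn G h) = Y h.
  by move=> hP; rewrite Yt hP eq_sym (negbTE neQP) addr0.
have t1 := t ((P, true), true) erefl; have t2 := t ((P, true), false) erefl.
have t3 := t ((P, false), true) erefl.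
move: t1 t2 t3; rewrite !turnE /flip /= => t1 t2 t3.
by case=> -[e b] b' /= ->; case: b b' => [] []; rewrite ?t3 ?t2 ?t1 F2_addxx.
Qed.

(** Descent on the size of [Y], which is intersected with the side at [Q] that avoids [P]. *)
Lemma pinched0 Y P c : pinched Y P c -> S P = 0.
Proof.
have [n] := ubnP #|[set h | Y h != 0]|.
elim: n Y P c => // n IH Y P c leY pY; case: (F2_cases (S P)) => // SP.
have [Q [neQP SQ YQ [Y0 /pinched_vanish/(_ neQP)[Y' [[Ya' Yt'] Y'P]]]]] := pinched_next pY SP.
have [Ya Yt] := pY.
(* At [Q] the factor [Y] is 1, so the jump of [Y'] survives; at [P] the factor [Y'] is 0 and kills
   the jump of [Y]. *)
have pZ : pinched (fun h => Y h * Y' h) Q (~~ c).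
  split=> h; first by rewrite Ya Ya'.
  rewrite Yt Yt'; have [hQ|_] := eqVneq h.1.1 Q.
    by rewrite hQ (negbTE neQP) addr0 YQ // !mul1r.
  by rewrite !addr0; have [/Y'P ->|_] := eqVneq h.1.1 P; rewrite ?mulr0 ?addr0.
suff lt : (#|[set h | (Y h * Y' h != 0)%R]| < n)%N.
  by have := IH (fun h => Y h * Y' h) _ _ lt pZ; rewrite SQ.
rewrite ltnS in leY; apply: leq_trans leY; apply: proper_card; apply/properP; split.
  by apply/subsetP=> h; rewrite !inE; apply: contra => /eqP ->; rewrite mul0r.
(* [Y] jumps at this turn, so one of its two half-edges has value 1 and is lost in the product. *)
have := Yt ((P, true), c); rewrite /= !eqxx /= => YP.
have [Y0'|Y1] := F2_cases (Y ((P, true), c)).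
  exists (medial_turn G ((P, true), c)); rewrite inE YP Y0' ?add0r //.
  by rewrite Y'P ?mulr0 ?eqxx // turnE; case: (c).
by exists ((P, true), c); rewrite inE ?Y1 // Y'P // mulr0 eqxx.
Qed.

Lemma kernel_org_loop e : o (e, true) = o (e, false) -> S e = 0.
Proof. by move/(even_is_cut_loop (even_org_is_cut E0)) => [A /pinched_left_face/pinched0]. Qed.

Lemma kernel_left_face_loop e : l (e, true) = l (e, false) -> S e = 0.
Proof. by move/(even_is_cut_loop (even_left_face_is_cut E0)) => [A /pinched_org/pinched0]. Qed.

End Kernel.

(** [inc] and [ends_mx] differ only on loops, and [S] vanishes there: by [pinched0] in one
    direction, by [even_loop0] in the other. *)
Lemma kernel_evenP (S : edge G -> 'F_2) :
  ((forall v, \sum_e S e * (inc o v e)%:R = 0) /\ (forall f, \sum_e S e * (inc l f e)%:R = 0))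
  <-> (even o S /\ even l S).
Proof.
split=> -[So Sl].
  by split=> v; rewrite -even_of_inc // => e;
    [apply: kernel_org_loop | apply: kernel_left_face_loop].
split=> v; rewrite even_of_inc //.
  by move=> e; apply: even_loop0 (even_org_is_cut E0) Sl.
by move=> e; apply: even_loop0 (even_left_face_is_cut E0) So.
Qed.

(** * Strand colourings and even sets of crossings *)

Lemma strand_switch (y : H -> 'F_2) (h : H) :
  (forall h, y (medial_turn G (medial_turn G h)) = y h) ->
  y ((h.1.1, true), true) + y ((h.1.1, true), false) = y h + y (medial_turn G h).
Proof.
(* Opposite half-edges share a colour, so any two consecutive ones show the same pair of colours. *)
move=> yt; case: h => [[e b] b']; rewrite turnE /=.
have yT := yt ((e, true), true); have yF := yt ((e, true), false).
rewrite !turnE /flip /= in yT yF.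
by case: b b' => [] []; rewrite ?turnE /flip /= ?yT ?yF // addrC.
Qed.

(** Around a region, [S] at each corner is a sum of two colours, and the arcs between consecutive
    corners make every colour occur twice. *)
Lemma strand_even (y : H -> 'F_2) (S : edge G -> 'F_2) :
  (forall h, y (medial_turn G (medial_turn G h)) = y h) ->
  (forall h, y (medial_arc G h) = y h) ->
  (forall h, S h.1.1 = y h + y (medial_turn G h)) -> even o S /\ even l S.
Proof.
move=> yt ya Sy; have Sd d : S d.1 = y (d, true) + y (d, false).
  by rewrite (Sy (d, true)) turnE.
split=> v; rewrite even_darts; under eq_bigr do rewrite Sd; rewrite big_split /=.
  rewrite [X in _ + X](reindex_inj (@perm_inj _ r)) /=.
  under [X in _ + X]eq_bigl do rewrite org_rotation.
  under [X in _ + X]eq_bigr => d _ do rewrite -ya arcE /= permK.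
  by rewrite F2_addxx.
rewrite [X in X + _](reindex_inj (@perm_inj _ (face_perm r))) /=.
under [X in X + _]eq_bigl do rewrite left_face_perm.
under eq_bigr => d _.
  rewrite face_permE.
  (* Straight on from [(d, false)] comes [(flip d, false)], whose arc ends at
     [(r^-1 (flip d), true)]. *)
  have -> : y (r^-1%g (flip d), true) = y (d, false).
    by rewrite -[RHS]yt -ya arcE !turnE /= permKV.
over.
by rewrite F2_addxx.
Qed.

Lemma even_strand (S : edge G -> 'F_2) : even o S -> even l S ->
  exists y : H -> 'F_2, [/\ forall h, y (medial_turn G (medial_turn G h)) = y h,
    forall h, y (medial_arc G h) = y h &
    forall h, S h.1.1 = y h + y (medial_turn G h)].
Proof.
move=> /(even_org_is_cut E0)[A SA] /(even_left_face_is_cut E0)[B SB].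
have dA d : B (o (flip d)) = B (o d) + S d.1.
  by case: d => e []; rewrite SB /flip /= ?F2_addKl ?F2_addKr.
have dB d : A (l (flip d)) = A (l d) + S d.1.
  by case: d => e []; rewrite SA /flip /= ?F2_addKl ?F2_addKr.
(* The half-edge [h] separates the vertex [o h.1] from this face, and [y] adds their colours. A turn
   passes either to the other end or to the other side of the edge; both add [S]. *)
pose y (h : H) := B (o h.1) + A (l (if h.2 then h.1 else flip h.1)).
have yt h : y (medial_turn G h) = y h + S h.1.1.
  case: h => d []; rewrite turnE /y /=; first by rewrite dB addrA.
  by rewrite dA addrAC.
have tS h : (medial_turn G h).1.1 = h.1.1 by rewrite turnE; case: ifP.
exists y; split=> h.
- by rewrite !yt tS -addrA F2_addxx addr0.
- case: h => d []; rewrite arcE /y /=; first by rewrite org_rotation left_face_flip_rotation.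
  by rewrite -(left_face_flip_rotation (r^-1%g d)) -[o (r^-1%g d)]org_rotation permKV.
- by rewrite yt addrA F2_addxx add0r.
Qed.

End Nugatory.

(** * Counting strand colourings *)

Section Count.
Variable G : connected_signed_plane_graph.
Hypothesis E0 : (#|edge G| != 0)%N.
Local Notation o := (@org G).
Local Notation l := (@left_face G).
Local Notation H := (dart G * bool)%type.

Lemma mul_incidenceP (K : graph) (u : 'rV['F_2]_#|edge K|) (S : edge K -> 'F_2) :
  (forall e, S e = u 0 (enum_rank e)) ->
  (u *m (incidence_mx K)^T = 0) <-> forall v, \sum_e S e * (inc (@org K) v e)%:R = 0.
Proof.
move=> Su; have E v : (u *m (incidence_mx K)^T) 0 (enum_rank v) = \sum_e S e * (inc (@org K) v e)%:R.
  rewrite mxE [RHS](reindex _ (onW_bij _ (@enum_val_bij (edge K)))) /=.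
  by apply: eq_bigr => j _; rewrite !mxE Su enum_valK enum_rankK.
split=> [u0 v|S0]; first by rewrite -E u0 mxE.
by apply/rowP=> i; rewrite -(enum_valK i) E S0 mxE.
Qed.

Lemma kernel_diagramP (u : 'rV['F_2]_#|edge G|) :
  u *m (diagram_incidence_mx G)^T = 0 <->
  even o (fun e => u 0 (enum_rank e)) /\ even l (fun e => u 0 (enum_rank e)).
Proof.
rewrite -(kernel_evenP E0) -(@mul_incidenceP G u) // -(@mul_incidenceP (dual G) u) //.
rewrite tr_col_mx mul_mx_row; split=> [/eqP|[-> ->]]; last exact: row_mx0.
by rewrite row_mx_eq0 => /andP[/eqP-> /eqP->].
Qed.

(** Both sides count strand colourings: by components, and by the set of switching crossings
    together with the colour of one half-edge, whence the factor 2. *)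
Lemma card_kernel_diagram :
  (2 ^ nb_components (diagram G) =
   2 ^ (#|edge G| - \rank (diagram_incidence_mx G)) * 2)%N.
Proof.
have turn4 (h : H) : medial_turn G (medial_turn G (medial_turn G (medial_turn G h))) = h.
  by case: h => d []; rewrite !turnE /= flipK.
have strand_sym : connect_sym (@same_strand (diagram G)).
  apply: sym_connect_sym => x y; rewrite /same_strand /=.
  by congr (_ || _); apply/eqP/eqP => ->; rewrite ?turn4 ?medial_arcK.
pose inv := [set y : {ffun H -> 'F_2} |
  [forall x, forall x', @same_strand (diagram G) x x' ==> (y x' == y x)]].
have invP (y : {ffun H -> 'F_2}) : reflect
    ((forall h, y (medial_turn G (medial_turn G h)) = y h) /\
     (forall h, y (medial_arc G h) = y h)) (y \in inv).
  rewrite inE; apply: (iffP forallP) => [yS|[yt ya] x].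
    by split=> h; apply/eqP; have /forallP := yS h; [move/(_ (medial_turn G (medial_turn G h))) |
      move/(_ (medial_arc G h))] => /implyP; apply; rewrite /same_strand /= eqxx ?orbT.
  by apply/forallP=> x'; apply/implyP=> /orP[] /eqP -> /=; rewrite ?yt ?ya.
pose K := [set u : 'rV_#|edge G| | u *m (diagram_incidence_mx G)^T == 0].
have cardK : #|K| = (2 ^ (#|edge G| - \rank (diagram_incidence_mx G)))%N.
  by rewrite card_ker_rV mxrank_tr card_Fp.
have cardI : #|inv| = (2 ^ nb_components (diagram G))%N.
  rewrite card_invariant // card_Fp // /nb_components.
  by rewrite [#|half_edge _|]card_medial_half muln_eq0 orbF (negbTE E0).
have /card_gt0P[y0 _] : (0 < #|edge G|)%N by rewrite lt0n.
pose h0 : H := ((y0, true), true).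
pose switch (y : {ffun H -> 'F_2}) e := y ((e, true), true) + y ((e, true), false).
pose f (y : {ffun H -> 'F_2}) :=
  (\row_(j < #|edge G|) switch y (enum_val j), y h0).
suff IK : #|inv| = #|setX K [set: 'F_2]|.
  by rewrite -cardI IK cardsX cardK cardsT card_Fp.
rewrite -(card_in_imset (f := f)).
  apply: eq_card => -[u a]; rewrite !inE andbT; apply/imsetP/eqP => [[y yI [-> _]]|/kernel_diagramP].
    apply/kernel_diagramP; have /invP[yt ya] := yI.
    by apply: (strand_even yt ya) => h; rewrite mxE enum_rankK -strand_switch.
  case=> /(even_strand E0) uS /uS[y [yt ya Sy]].
  (* The constant shift keeps all switches and gives [h0] the colour [a]. *)
  exists [ffun h => y h + (a + y h0)].
    by apply/invP; split=> h; rewrite !ffunE ?yt ?ya.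
  congr (_, _); last by rewrite ffunE addrC -addrA F2_addxx addr0.
  apply/rowP=> j; rewrite mxE /switch !ffunE addrACA F2_addxx addr0.
  have := Sy ((enum_val j, true), true); rewrite turnE /= enum_valK //.
(* Injectivity: equal switches make [y + z] invariant under turns as well as arcs, hence constant,
   and it vanishes at [h0]. *)
move=> y z /invP[yt ya] /invP[zt za] [/rowP yz yz0]; apply/ffunP=> h.
apply: F2_add_eq0; rewrite -[RHS](F2_addxx (z h0)) -{1}yz0.
apply: (half_edge_const (g := fun h => y h + z h)) => x; last by rewrite ya za.
have := yz (enum_rank x.1.1); rewrite !mxE enum_rankK /switch !strand_switch // => /eqP.
rewrite -subr_eq0 F2_opp addrACA addr_eq0 F2_opp => /eqP.
by move=> ->.
Qed.
End Count.

End Duality.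

Theorem theorem1p4 (G : connected_signed_plane_graph) (n : nat) (hn : 1 <= n) :
  nb_components (diagram G) = n <->
  ((\rank (diagram_incidence_mx G))%:Z = #|edge G|%:Z - n%:Z + 1)%R.
Proof.
have le_rank := rank_leq_col (diagram_incidence_mx G).
suff nbE : nb_components (diagram G) + \rank (diagram_incidence_mx G) = #|edge G| + 1.
  by split=> [<-|rE]; lia.
(* Without edges the diagram is a circle: one component, rank 0. *)
have [E0|E0] := eqVneq #|edge G| 0.
  move: le_rank; rewrite [X in _ <= X]E0 leqn0 => /eqP ->.
  by rewrite /nb_components [#|half_edge _|]card_medial_half E0.
(* By [le_rank] the natural subtraction in the exponent is exact. *)
have /eqP := card_kernel_diagram E0; rewrite -expnSr eqn_exp2l // => /eqP ->.
by rewrite addSn subnK // addn1.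
Qed.
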